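(* Let $K$ be a number field. There are infinitely many elliptic curves over $K$ with rank at least $6$.
   Context: The rank of an elliptic curve $E$ over $K$ is the rank of its Mordell-Weil group $E(K)$, the finitely generated abelian group of $K$-rational points of $E$. *)

(* Defs.v *)
From HB Require Import structures.
From mathcomp Require Import all_boot all_order all_algebra all_field.
From mathcomp Require Import ring zify.
From mathcomp Require Import classical_sets functions cardinality.

Set Implicit Arguments.
Unset Strict Implicit.
Unset Printing Implicit Defensive.

Import GRing.Theory.
Local Open Scope ring_scope.

(* Elliptic curves are given by (long) Weierstrass equations
     y^2 + a1 x y + a3 y = x^3 + a2 x^2 + a4 x + a6
   with the usual b-invariants and discriminant. *)
Definition weierstrass_disc (F : fieldType) (a1 a2 a3 a4 a6 : F) : F :=
  let b2 := a1 ^+ 2 + 4 * a2 in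
  let b4 := 2 * a4 + a1 * a3 in
  let b6 := a3 ^+ 2 + 4 * a6 in
  let b8 := a1 ^+ 2 * a6 + 4 * a2 * a6 - a1 * a3 * a4 + a2 * a3 ^+ 2
            - a4 ^+ 2 in
  - b2 ^+ 2 * b8 - 8 * b4 ^+ 3 - 27 * b6 ^+ 2 + 9 * b2 * b4 * b6.

Record ellcurve (F : fieldType) := EllCurve {
  a1 : F; a2 : F; a3 : F; a4 : F; a6 : F;
  disc_neq0 : weierstrass_disc a1 a2 a3 a4 a6 != 0
}.

(* F-isomorphisms are the admissible changes of variables
   x = u^2 x' + r,  y = u^3 y' + s u^2 x' + t  with u, r, s, t in F, u != 0. *)
Definition isomorphic (F : fieldType) (E E' : ellcurve F) : Prop :=
  exists u r s t : F, [/\ u != 0,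
    u * a1 E' = a1 E + 2 * s,
    u ^+ 2 * a2 E' = a2 E - s * a1 E + 3 * r - s ^+ 2
  & [/\ u ^+ 3 * a3 E' = a3 E + r * a1 E + 2 * t,
    u ^+ 4 * a4 E' = a4 E - s * a3 E + 2 * r * a2 E - (t + r * s) * a1 E
                     + 3 * r ^+ 2 - 2 * s * t
  & u ^+ 6 * a6 E' = a6 E + r * a4 E + r ^+ 2 * a2 E + r ^+ 3 - t * a3 E
                     - t ^+ 2 - r * t * a1 E]].

Definition isomorphism_class (F : fieldType) (E : ellcurve F) :
  set (ellcurve F) := [set E' | isomorphic E E']%classic.

(* Points: [None] is the point at infinity. *)
Section Operations.
Variables (F : fieldType) (E : ellcurve F).

Definition on_curve (P : option (F * F)) : bool :=
  if P is Some (x, y) then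
    y ^+ 2 + a1 E * x * y + a3 E * y
      == x ^+ 3 + a2 E * x ^+ 2 + a4 E * x + a6 E
  else true.

Definition negY (x y : F) : F := - y - a1 E * x - a3 E.

Definition negp (P : option (F * F)) : option (F * F) :=
  if P is Some (x, y) then Some (x, negY x y) else None.

(* Slope of the chord, or of the tangent if x1 = x2; in the latter case it is
   only used when the two points coincide and are not 2-torsion. *)
Definition slope (x1 y1 x2 y2 : F) : F :=
  if x1 == x2 then
    (3 * x1 ^+ 2 + 2 * a2 E * x1 + a4 E - a1 E * y1)
      / (2 * y1 + a1 E * x1 + a3 E)
  else (y2 - y1) / (x2 - x1).

Definition addp (P Q : option (F * F)) : option (F * F) :=
  match P, Q with
  | None, _ => Q
  | _, None => P
  | Some (x1, y1), Some (x2, y2) =>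
    if (x1 == x2) && (y1 == negY x2 y2) then None else
    let l := slope x1 y1 x2 y2 in
    let x3 := l ^+ 2 + a1 E * l - a2 E - x1 - x2 in
    Some (x3, negY x3 (l * (x3 - x1) + y1))
  end.

End Operations.

(* The group axioms for [addp] are proved by attaching to a point P its
   ideal I_P in the coordinate ring, and checking that P |-> [I_P] is an
   injective map to ideal classes compatible with the operations.
   Ideals are handled through sets of generators. *)
Section Span.
Variable R : comNzRingType.
Implicit Types (G H K : R -> Prop) (f g z : R).

Inductive span G : R -> Prop :=
| span0 : span G 0
| spanD a g z : G g -> span G z -> span G (a * g + z).

Definition single f : R -> Prop := fun z => z = f.
Definition mulG G H : R -> Prop := fun z => exists2 a, G a & exists2 b, H b & z = a * b.
Definition leG G H := forall g, G g -> span H g.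
Definition eqG G H := leG G H /\ leG H G.

Lemma span_gen G g : G g -> span G g.
Proof. by move=> Gg; rewrite -[g]addr0 -[g]mul1r; apply: spanD => //; apply: span0. Qed.

Lemma span_add G z z' : span G z -> span G z' -> span G (z + z').
Proof.
by move=> Gz Gz'; elim: Gz => [|a g w Gg _ IH]; rewrite ?add0r // -addrA; apply: spanD.
Qed.

Lemma span_mul G a z : span G z -> span G (a * z).
Proof.
elim=> [|b g w Gg _ IH]; first by rewrite mulr0; apply: span0.
by rewrite mulrDr mulrA; apply: spanD.
Qed.

Lemma span_le G H z : leG G H -> span G z -> span H z.
Proof.
move=> GH; elim=> [|b g w Gg _ IH]; first exact: span0.
by apply: span_add => //; apply/span_mul/GH.
Qed.

Lemma span_dvd f G z : span (mulG (single f) G) z -> exists2 w, span G w & z = f * w.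
Proof.
elim=> [|b g w [_ -> [c Gc ->]] _ [v Gv ->]]; first by exists 0; rewrite ?mulr0 //; apply: span0.
by exists (b * c + v); [apply: spanD | ring].
Qed.

Lemma leG_mull G G' H : leG G G' -> leG (mulG G H) (mulG G' H).
Proof.
move=> le _ [a /le Ga [b Hb ->]]; elim: Ga => [|c g w Gg _ IH].
  by rewrite mul0r; apply: span0.
by rewrite mulrDl -mulrA; apply: spanD => //; exists g => //; exists b.
Qed.

Lemma eqG_refl G : eqG G G. Proof. by split=> g; apply: span_gen. Qed.
Lemma eqG_sym G H : eqG G H -> eqG H G. Proof. by case. Qed.
Lemma eqG_trans G H K : eqG G H -> eqG H K -> eqG G K.
Proof.
move=> [GH HG] [HK KH]; split=> g; first by move/GH; apply: span_le.
by move/KH; apply: span_le.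
Qed.
Lemma eqG_ext G H : (forall z, G z <-> H z) -> eqG G H.
Proof. by move=> GH; split=> g /GH; apply: span_gen. Qed.
Lemma eqG_mull G G' H : eqG G G' -> eqG (mulG G H) (mulG G' H).
Proof. by move=> [l r]; split; apply: leG_mull. Qed.
Lemma mulGC G H : eqG (mulG G H) (mulG H G).
Proof.
by apply: eqG_ext => z; split=> -[a Ga [b Gb ->]]; exists b => //; exists a; rewrite // mulrC.
Qed.
Lemma mulGA G H K : eqG (mulG G (mulG H K)) (mulG (mulG G H) K).
Proof.
apply: eqG_ext => z; split.
  move=> [a Ga [_ [b Hb [c Kc ->]] ->]]; exists (a * b); first by exists a => //; exists b.
  by exists c; rewrite // mulrA.
move=> [_ [a Ga [b Hb ->]] [c Kc ->]]; exists a => //.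
by exists (b * c); rewrite ?mulrA //; exists b => //; exists c.
Qed.
Lemma eqG_mulr G H H' : eqG H H' -> eqG (mulG G H) (mulG G H').
Proof.
by move=> e; apply: eqG_trans (mulGC _ _) _; apply: eqG_trans (eqG_mull _ e) (mulGC _ _).
Qed.
Lemma mul1G G : eqG (mulG (single 1) G) G.
Proof.
apply: eqG_ext => z; split; first by move=> [_ -> [b Gb ->]]; rewrite mul1r.
by move=> Gz; exists 1 => //; exists z; rewrite // mul1r.
Qed.
Lemma mulG1 G : eqG (mulG G (single 1)) G.
Proof. exact: eqG_trans (mulGC _ _) (mul1G _). Qed.
Lemma single_mul f g : eqG (single (f * g)) (mulG (single f) (single g)).
Proof.
by apply: eqG_ext => z; split=> [->|[_ -> [_ -> ->]]] //; exists f => //; exists g.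
Qed.

Hypothesis reg : forall f g, f * g = 0 -> f = 0 \/ g = 0.

Definition cls G H := exists f g, [/\ f != 0, g != 0 & eqG (mulG (single f) G) (mulG (single g) H)].

Lemma mulf_neq0_reg f g : f != 0 -> g != 0 -> f * g != 0.
Proof. by move=> /eqP f0 /eqP g0; apply/eqP=> /reg []. Qed.

Lemma eqG_cls G H : eqG G H -> cls G H.
Proof. by move=> e; exists 1, 1; rewrite oner_neq0; split=> //; apply: eqG_mulr. Qed.

Lemma cls_sym G H : cls G H -> cls H G.
Proof. by move=> [f [g [f0 g0 /eqG_sym e]]]; exists g, f. Qed.

Lemma singleM_eq f f' G : eqG (mulG (single (f * f')) G) (mulG (single f) (mulG (single f') G)).
Proof.
by apply: eqG_trans (eqG_mull _ (single_mul _ _)) (eqG_sym (mulGA _ _ _)).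
Qed.

Lemma cls_trans G H K : cls G H -> cls H K -> cls G K.
Proof.
move=> [f [g [f0 g0 e]]] [f' [g' [f'0 g'0 e']]].
exists (f' * f), (g * g'); split; try exact: mulf_neq0_reg.
apply: eqG_trans (singleM_eq _ _ _) _; apply: eqG_trans (eqG_mulr _ e) _.
apply: eqG_trans (eqG_sym (singleM_eq _ _ _)) _; rewrite mulrC.
apply: eqG_trans (singleM_eq _ _ _) _; apply: eqG_trans (eqG_mulr _ e') _.
exact: eqG_sym (singleM_eq _ _ _).
Qed.

Lemma cls_mull G G' H : cls G G' -> cls (mulG G H) (mulG G' H).
Proof.
move=> [f [g [f0 g0 e]]]; exists f, g; split=> //.
apply: eqG_trans (mulGA _ _ _) _; apply: eqG_trans (eqG_mull _ e) _.
exact: eqG_sym (mulGA _ _ _).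
Qed.

Lemma cls_mulr G H H' : cls H H' -> cls (mulG G H) (mulG G H').
Proof.
move=> e; apply: cls_trans (eqG_cls (mulGC _ _)) _.
by apply: cls_trans (cls_mull _ e) (eqG_cls (mulGC _ _)).
Qed.

Lemma cls_single f : f != 0 -> cls (single f) (single 1).
Proof.
move=> f0; exists 1, f; split; rewrite ?oner_neq0 //.
exact: eqG_trans (mul1G _) (eqG_sym (mulG1 _)).
Qed.

End Span.

(* The coordinate ring F[X, Y] / (Y^2 + b Y - c), as the set of p + q Y. *)
Section Coord.
Variable F : fieldType.

Definition coord (b c : {poly F}) := ({poly F} * {poly F})%type.

Variables b c : {poly F}.
Local Notation R := (coord b c).
HB.instance Definition _ := GRing.Zmodule.copy R ({poly F} * {poly F})%type.

Definition coord_mul (u v : R) : R :=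
  (u.1 * v.1 + u.2 * v.2 * c, u.1 * v.2 + u.2 * v.1 - b * u.2 * v.2).

Lemma coord_eq (u v : R) : u.1 = v.1 -> u.2 = v.2 -> u = v.
Proof. by case: u v => [? ?] [? ?] /= -> ->. Qed.
Fact coord_mulA : associative coord_mul.
Proof. by move=> u v w; apply: coord_eq => /=; ring. Qed.
Fact coord_mulC : commutative coord_mul.
Proof. by move=> u v; apply: coord_eq => /=; ring. Qed.
Fact coord_mul1 : left_id ((1, 0) : R) coord_mul.
Proof. by move=> u; apply: coord_eq => /=; ring. Qed.
Fact coord_mulD : left_distributive coord_mul +%R.
Proof. by move=> u v w; apply: coord_eq => /=; ring. Qed.
Fact coord_1neq0 : ((1, 0) : R) != 0.
Proof. by apply/eqP => -[] /eqP; rewrite oner_eq0. Qed.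
HB.instance Definition _ := GRing.Zmodule_isComNzRing.Build R
  coord_mulA coord_mulC coord_mul1 coord_mulD coord_1neq0.

Definition coordC (a : F) : R := (a%:P, 0).
Definition coordX : R := ('X, 0).
Definition coordY : R := (0, 1).

Fact coordC_zmod : zmod_morphism coordC.
Proof. by move=> x y; apply: coord_eq => /=; rewrite ?polyCB ?subr0. Qed.
Fact coordC_monoid : monoid_morphism coordC.
Proof. by split=> // x y; apply: coord_eq => /=; rewrite ?polyCM; ring. Qed.
HB.instance Definition _ := GRing.isZmodMorphism.Build F R coordC coordC_zmod.
HB.instance Definition _ := GRing.isMonoidMorphism.Build F R coordC coordC_monoid.

Definition cnorm (u : R) := u.1 ^+ 2 - b * u.1 * u.2 - c * u.2 ^+ 2.

Lemma cnormM u v : cnorm (u * v) = cnorm u * cnorm v.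
Proof. rewrite /cnorm /=; ring. Qed.

Hypothesis size_b : (size b <= 2)%N.
Hypothesis size_c : (size c = 4)%N.

Lemma size_norm_poly (p q : {poly F}) : q != 0 ->
  (3 < size (p ^+ 2 - b * p * q - c * q ^+ 2)%R)%N.
Proof.
move=> q0.
have c0 : c != 0 by rewrite -size_poly_gt0 size_c.
have sq0 : (0 < size q)%N by rewrite size_poly_gt0.
have scq : size (c * q ^+ 2) = (2 * size q + 2)%N.
  rewrite expr2 !size_mul ?mulf_neq0 // size_c; move: (size q) sq0 => n; lia.
have [->|p0] := eqVneq p 0.
  by rewrite mulr0 mul0r expr0n /= !sub0r oppr0 add0r size_polyN scq; lia.
have sp0 : (0 < size p)%N by rewrite size_poly_gt0.
have sp : size (p ^+ 2) = (2 * size p - 1)%N by 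
  rewrite expr2 size_mul //; move: (size p) sp0 => n; lia.
have sb : (size (b * p * q)%R <= size p + size q)%N.
  apply: leq_trans (size_polyMleq _ _) _; have := size_polyMleq b p.
  move: (size (b * p)) (size b) (size p) (size q) size_b sp0 sq0; lia.
rewrite -addrA; have [le|lt] := leqP (size p) (size q + 1).
  rewrite addrA addrC size_polyDl size_polyN scq; first by move: (size q) sq0; lia.
  apply: leq_ltn_trans (size_polyD _ _) _; rewrite size_polyN sp.
  move: (size (b * p * q)) (size q) (size p) sb sq0 sp0 le; lia.
rewrite size_polyDl sp; first by move: (size q) (size p) sq0 lt; lia.
apply: leq_ltn_trans (size_polyD _ _) _; rewrite !size_polyN scq.
move: (size (b * p * q)) (size q) (size p) sb sq0 sp0 lt; lia.
Qed.

Lemma size_cnorm u : u.2 != 0 -> (3 < size (cnorm u))%N.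
Proof. by case: u => p q; apply: size_norm_poly. Qed.

Lemma cnorm_eq0 u : cnorm u = 0 -> u = 0.
Proof.
move=> Nu; have [q0|/size_cnorm] := eqVneq u.2 0; last by rewrite Nu size_poly0.
apply: coord_eq => //=; apply/eqP; move: Nu.
by rewrite /cnorm q0 mulr0 expr0n /= mulr0 !subr0 => /eqP; rewrite expf_eq0.
Qed.

Lemma coord_reg (u v : R) : u * v = 0 -> u = 0 \/ v = 0.
Proof.
move=> uv; have /eqP : cnorm u * cnorm v = 0.
  by rewrite -cnormM uv /cnorm /=; ring.
by rewrite mulf_eq0 => /orP[] /eqP /cnorm_eq0; [left | right].
Qed.

Lemma coord_Xsub_neq0 x : coordX - coordC x != 0.
Proof. by apply/eqP => -[] /eqP; rewrite polyXsubC_eq0. Qed.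

Lemma coord_Ysub_neq0 (p : {poly F}) : coordY - ((p, 0) : R) != 0.
Proof. by apply/eqP => -[] _ /eqP; rewrite subr0 oner_eq0. Qed.

(* A common divisor of X - x and Y - y is a unit polynomial. *)
Lemma coord_gcd x y (h k m : R) :
    coordX - coordC x = h * k -> coordY - coordC y = h * m ->
  exists2 p : {poly F}, h = (p, 0) & exists r, p * r = 1.
Proof.
move=> Ex Ey.
have Nx : cnorm h * cnorm k = ('X - x%:P) ^+ 2.
  by rewrite -cnormM -Ex /cnorm /= subr0 mulr0 expr0n /= mulr0 !subr0.
have s3 : size (cnorm h * cnorm k) = 3.
  by rewrite Nx expr2 size_mul ?polyXsubC_eq0 // !size_XsubC.
have [h0 k0] : cnorm h != 0 /\ cnorm k != 0.
  by split; apply/eqP => N0; move: s3; rewrite N0 ?mulr0 ?mul0r size_poly0.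
have h2 : h.2 = 0.
  apply/eqP/negPn/negP => /size_cnorm lt; move: s3; rewrite size_mul //.
  have k1 : (0 < size (cnorm k))%N by rewrite size_poly_gt0.
  by move: (size (cnorm h)) (size (cnorm k)) lt k1; lia.
exists h.1; first exact: coord_eq.
exists m.2; move: (congr1 snd Ey); rewrite /= subr0 h2 => ->; ring.
Qed.

End Coord.

Section PointIdeals.
Variables (F : fieldType) (E : ellcurve F).
Implicit Types x y : F.
Local Notation "'a1'" := (a1 E).
Local Notation "'a2'" := (a2 E).
Local Notation "'a3'" := (a3 E).
Local Notation "'a4'" := (a4 E).
Local Notation "'a6'" := (a6 E).

Lemma nonsingular x y : on_curve E (Some (x, y)) ->
    2 * y + a1 * x + a3 = 0 -> 3 * x ^+ 2 + 2 * a2 * x + a4 - a1 * y = 0 ->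
  False.
Proof.
move=> /eqP W Wy Wx; have /eqP := disc_neq0 E; apply.
pose A2 := a2 + 3 * x.
pose A3 := a3 + x * a1 + 2 * y.
pose A4 := a4 + 2 * x * a2 - y * a1 + 3 * x ^+ 2.
pose A6 := a6 + x * a4 + x ^+ 2 * a2 + x ^+ 3 - y * a3 - y ^+ 2 - x * y * a1.
have -> : weierstrass_disc a1 a2 a3 a4 a6 = weierstrass_disc a1 A2 A3 A4 A6.
  rewrite /weierstrass_disc /A2 /A3 /A4 /A6; ring.
have -> : A3 = 0 by rewrite -Wy /A3; ring.
have -> : A4 = 0 by rewrite -Wx /A4; ring.
have -> : A6 = 0.
  transitivity (x ^+ 3 + a2 * x ^+ 2 + a4 * x + a6 - (y ^+ 2 + a1 * x * y + a3 * y)).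
    by rewrite /A6; ring.
  by rewrite W subrr.
rewrite /weierstrass_disc; ring.
Qed.

Lemma slopeP x1 y1 x2 y2 (l := slope E x1 y1 x2 y2) :
    on_curve E (Some (x1, y1)) -> on_curve E (Some (x2, y2)) ->
    (x1 == x2) && (y1 == negY E x2 y2) = false ->
  y2 = l * (x2 - x1) + y1 /\
  (x1 != x2 \/ [/\ x1 = x2, 2 * y1 + a1 * x1 + a3 != 0 &
    l * (2 * y1 + a1 * x1 + a3) = 3 * x1 ^+ 2 + 2 * a2 * x1 + a4 - a1 * y1]).
Proof.
move=> /eqP W1 /eqP W2; rewrite /l /slope; have [x12|x12] /= := eqVneq x1 x2; last first.
  by move=> _; split; [field; rewrite subr_eq0 eq_sym | left].
subst x2 => neg; have y12 : y1 = y2.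
  have /eqP : (y1 - y2) * (y1 - negY E x1 y2) = 0.
    transitivity ((y1 ^+ 2 + a1 * x1 * y1 + a3 * y1) -
        (y2 ^+ 2 + a1 * x1 * y2 + a3 * y2)); first by rewrite /negY; ring.
    by rewrite W1 W2 subrr.
  by rewrite mulf_eq0 !subr_eq0 neg orbF => /eqP.
subst y2; have d0 : 2 * y1 + a1 * x1 + a3 != 0.
  by move/negbT: neg; rewrite -subr_eq0 /negY; congr (_ != 0); ring.
by split; [ring | right; split=> //; rewrite divfK].
Qed.

(* The cubic cut out on the line y = l x + m has roots x1, x2, x3. *)
Lemma line_coefs x1 y1 x2 y2 (l := slope E x1 y1 x2 y2) (m := y1 - l * x1)
    (x3 := l ^+ 2 + a1 * l - a2 - x1 - x2) :
    on_curve E (Some (x1, y1)) -> on_curve E (Some (x2, y2)) ->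
    (x1 == x2) && (y1 == negY E x2 y2) = false ->
  a4 = a1 * m + a3 * l + 2 * l * m + (x1 * x2 + x1 * x3 + x2 * x3) /\
  a6 = a3 * m + m ^+ 2 - x1 * x2 * x3.
Proof.
move=> W1 W2 neg; have [] := slopeP W1 W2 neg; rewrite -/l => y2E tg.
move: W1 W2 => /eqP W1 /eqP W2.
pose al := a4 - (a1 * m + a3 * l + 2 * l * m + (x1 * x2 + x1 * x3 + x2 * x3)).
pose be := a6 - (a3 * m + m ^+ 2 - x1 * x2 * x3).
have ab1 : al * x1 + be = 0.
  transitivity (x1 ^+ 3 + a2 * x1 ^+ 2 + a4 * x1 + a6
    - (y1 ^+ 2 + a1 * x1 * y1 + a3 * y1)); first by rewrite /al /be /x3 /m; ring.
  by rewrite W1 subrr.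
have ab2 : al * x2 + be = 0.
  transitivity (x2 ^+ 3 + a2 * x2 ^+ 2 + a4 * x2 + a6
    - (y2 ^+ 2 + a1 * x2 * y2 + a3 * y2)); first by rewrite y2E /al /be /x3 /m; ring.
  by rewrite W2 subrr.
have al0 : al = 0.
  case: tg => [x12 | [x12 _ tg]].
    have /eqP : al * (x1 - x2) = 0.
      by transitivity ((al * x1 + be) - (al * x2 + be)); [ring | rewrite ab1 ab2 subrr].
    by rewrite mulf_eq0 (subr_eq0 x1) (negPf x12) orbF => /eqP.
  transitivity (3 * x1 ^+ 2 + 2 * a2 * x1 + a4 - a1 * y1
                - l * (2 * y1 + a1 * x1 + a3)).
    by rewrite /al /x3 /m -x12; ring.
  by rewrite tg subrr.
have be0 : be = 0 by rewrite -ab1 al0 mul0r add0r.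
by split; apply/subr0_eq.
Qed.

Lemma on_curve_neg P : on_curve E P -> on_curve E (negp E P).
Proof.
case: P => [[x y]|] //= /eqP W; rewrite -W /negY; apply/eqP; ring.
Qed.

Lemma on_curve_add P Q : on_curve E P -> on_curve E Q -> on_curve E (addp E P Q).
Proof.
case: P Q => [[x1 y1]|] [[x2 y2]|] // W1 W2; rewrite /addp.
case: ifP => // neg; have [] := line_coefs W1 W2 neg.
set l := slope _ _ _ _ _; set x3 := _ - x2 => e4 e6.
apply/eqP; rewrite e4 e6 /negY /x3; ring.
Qed.

Definition wb : {poly F} := a1%:P * 'X + a3%:P.
Definition wc : {poly F} := 'X ^+ 3 + a2%:P * 'X ^+ 2 + a4%:P * 'X + a6%:P.
Local Notation R := (coord wb wc).
Local Notation k := (@coordC F wb wc).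
Local Notation X := (@coordX F wb wc).
Local Notation Y := (@coordY F wb wc).

Lemma size_wb : (size wb <= 2)%N.
Proof.
rewrite /wb; apply: leq_trans (size_polyD _ _) _; rewrite geq_max.
rewrite (leq_trans (size_polyC_leq1 _)) // andbT.
by apply: leq_trans (size_polyMleq _ _) _; rewrite size_polyX; have := size_polyC_leq1 a1; lia.
Qed.

Lemma size_wc : size wc = 4.
Proof.
rewrite /wc -!addrA size_polyDl size_polyXn //.
apply: leq_ltn_trans (size_polyD _ _) _; rewrite gtn_max; apply/andP; split.
  apply: leq_ltn_trans (size_polyMleq _ _) _; rewrite size_polyXn.
  by have := size_polyC_leq1 a2; lia.
apply: leq_ltn_trans (size_polyD _ _) _; rewrite gtn_max; apply/andP; split.
  apply: leq_ltn_trans (size_polyMleq _ _) _; rewrite size_polyX.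
  by have := size_polyC_leq1 a4; lia.
by have := size_polyC_leq1 a6; lia.
Qed.

Let reg := @coord_reg F wb wc size_wb size_wc.
Local Notation cls := (@cls R).

Lemma coord_rel : Y ^+ 2 + k a1 * X * Y + k a3 * Y = X ^+ 3 + k a2 * X ^+ 2 + k a4 * X + k a6.
Proof. by rewrite !exprS expr0; apply: coord_eq => /=; rewrite /wb /wc; ring. Qed.

Definition pideal (P : option (F * F)) : R -> Prop :=
  if P is Some (x, y) then fun z => z = X - k x \/ z = Y - k y else single 1.

Lemma pideal_neg x y : on_curve E (Some (x, y)) ->
  eqG (mulG (pideal (Some (x, y))) (pideal (negp E (Some (x, y))))) (single (X - k x)).
Proof.
move=> W; have YY : (Y - k y) * (Y - k (negY E x y)) = (X - k x) *
    (X ^+ 2 + k x * X + k x ^+ 2 + k a2 * (X + k x) + k a4 - k a1 * Y).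
  apply/subr0_eq; transitivity
    ((Y ^+ 2 + k a1 * X * Y + k a3 * Y) - (X ^+ 3 + k a2 * X ^+ 2 + k a4 * X + k a6)
      - k ((y ^+ 2 + a1 * x * y + a3 * y) - (x ^+ 3 + a2 * x ^+ 2 + a4 * x + a6))).
    by rewrite /negY; ring.
  by rewrite coord_rel (eqP W) !subrr.
have dvd z w : z = (X - k x) * w -> span (single (X - k x)) z.
  by move=> ->; rewrite mulrC; apply/span_mul/span_gen.
split.
  move=> _ [g [->|->] [h [->|->] ->]]; first exact: dvd erefl.
  - exact: dvd erefl.
  - exact: dvd (mulrC _ _).
  - exact: dvd YY.
move=> _ ->; set S := span _.
have S1 : S ((X - k x) * (X - k x)).
  by apply: span_gen; exists (X - k x); [left | exists (X - k x); [left |]].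
have S2 : S ((X - k x) * (Y - k (negY E x y))).
  by apply: span_gen; exists (X - k x); [left | exists (Y - k (negY E x y)); [right |]].
have S3 : S ((Y - k y) * (X - k x)).
  by apply: span_gen; exists (Y - k y); [right | exists (X - k x); [left |]].
have S4 : S ((Y - k y) * (Y - k (negY E x y))).
  by apply: span_gen; exists (Y - k y); [right | exists (Y - k (negY E x y)); [right |]].
have unit d : d != 0 -> S (k d * (X - k x)) -> S (X - k x).
  move=> d0 /(span_mul (k d^-1)); by rewrite mulrA -rmorphM mulVf // rmorph1 mul1r.
have [d0|] := eqVneq (2 * y + a1 * x + a3) 0; last first.
  move/unit; apply; have -> : k (2 * y + a1 * x + a3) * (X - k x) =
      1 * ((X - k x) * (Y - k (negY E x y))) + (-1) * ((Y - k y) * (X - k x)).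
    by rewrite /negY; ring.
  by apply: span_add; apply: span_mul.
have /unit : 3 * x ^+ 2 + 2 * a2 * x + a4 - a1 * y != 0.
  by apply/eqP => /(nonsingular W d0).
apply; have -> : k (3 * x ^+ 2 + 2 * a2 * x + a4 - a1 * y) * (X - k x) =
    1 * ((Y - k y) * (Y - k (negY E x y)))
    + ((- (X + 2 * k x + k a2)) * ((X - k x) * (X - k x))
    + k a1 * ((Y - k y) * (X - k x))).
  by rewrite YY; ring.
by do ?apply: span_add; apply: span_mul.
Qed.

Definition lideal x (L : R) : R -> Prop := fun z => z = X - k x \/ z = Y - L.

Lemma pideal_line x y (a : F) (L : R) :
  L = k a * (X - k x) + k y -> eqG (pideal (Some (x, y))) (lideal x L).
Proof.
move=> ->; split=> z [] ->.
- by apply: span_gen; left.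
- have -> : Y - k y = k a * (X - k x) + (1 * (Y - (k a * (X - k x) + k y)) + 0) by ring.
  by apply: spanD; [left | apply: spanD; [right | apply: span0]].
- by apply: span_gen; left.
- have -> : Y - (k a * (X - k x) + k y) = (- k a) * (X - k x) + (1 * (Y - k y) + 0) by ring.
  by apply: spanD; [left | apply: spanD; [right | apply: span0]].
Qed.

Lemma pideal_chord x1 y1 x2 y2 (l := slope E x1 y1 x2 y2)
    (x3 := l ^+ 2 + a1 * l - a2 - x1 - x2) :
    on_curve E (Some (x1, y1)) -> on_curve E (Some (x2, y2)) ->
    (x1 == x2) && (y1 == negY E x2 y2) = false ->
  cls (mulG (pideal (Some (x1, y1))) (pideal (Some (x2, y2))))
    (pideal (Some (x3, negY E x3 (l * (x3 - x1) + y1)))).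
Proof.
move=> W1 W2 neg; pose L := k l * (X - k x1) + k y1.
pose L' := - L - k a1 * X - k a3.
have [y2E tg] := slopeP W1 W2 neg; rewrite -/l in y2E tg.
have prod : (Y - L) * (Y - L') = (X - k x1) * (X - k x2) * (X - k x3).
  have [e4 e6] := line_coefs W1 W2 neg; rewrite -/l -/x3 in e4 e6.
  apply/subr0_eq; transitivity ((Y ^+ 2 + k a1 * X * Y + k a3 * Y)
     - (X ^+ 3 + k a2 * X ^+ 2 + k a4 * X + k a6)); last by rewrite coord_rel subrr.
  rewrite e4 e6 /L' /L /x3; ring.
have e1 : eqG (pideal (Some (x1, y1))) (lideal x1 L) by exact: pideal_line.
have e2 : eqG (pideal (Some (x2, y2))) (lideal x2 L).
  by apply: (@pideal_line _ _ l); rewrite y2E /L; ring.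
have e3 : eqG (pideal (Some (x3, negY E x3 (l * (x3 - x1) + y1)))) (lideal x3 L').
  by apply: (@pideal_line _ _ (- l - a1)); rewrite /L' /L /negY; ring.
apply: (cls_trans reg (eqG_cls (eqG_trans (eqG_mull _ e1) (eqG_mulr _ e2)))).
apply: (cls_trans reg) (cls_sym (eqG_cls e3)).
exists (X - k x3), (Y - L); split; first exact: coord_Xsub_neq0.
  have -> : L = (l%:P * ('X - x1%:P) + y1%:P, 0) by apply: coord_eq => /=; ring.
  exact: coord_Ysub_neq0.
have memT (G : R -> Prop) z g w : G g -> z = w * g -> span G z.
  by move=> Gg ->; apply/span_mul/span_gen.
split.
  have g1 : mulG (single (Y - L)) (lideal x3 L') ((Y - L) * (X - k x3)).
    by exists (Y - L) => //; exists (X - k x3) => //; left.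
  have g2 : mulG (single (Y - L)) (lideal x3 L') ((Y - L) * (Y - L')).
    by exists (Y - L) => //; exists (Y - L') => //; right.
  move=> _ [_ -> [_ [g [->|->] [h [->|->] ->]] ->]].
  - by apply: (memT _ _ _ 1 g2); rewrite prod; ring.
  - by apply: (memT _ _ _ (X - k x1) g1); ring.
  - by apply: (memT _ _ _ (X - k x2) g1); ring.
  - by apply: (memT _ _ _ (Y - L) g1); ring.
set G := mulG (single (X - k x3)) _.
have mem g h : lideal x1 L g -> lideal x2 L h -> G ((X - k x3) * (g * h)).
  by move=> Gg Gh; exists (X - k x3) => //; exists (g * h) => //; exists g => //; exists h.
have g11 : G ((X - k x3) * ((X - k x1) * (X - k x2))) by apply: mem; left.
have g12 : G ((X - k x3) * ((X - k x1) * (Y - L))) by apply: mem; [left | right].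
have g21 : G ((X - k x3) * ((Y - L) * (X - k x2))) by apply: mem; [right | left].
have g22 : G ((X - k x3) * ((Y - L) * (Y - L))) by apply: mem; right.
move=> _ [_ -> [_ [->|->] ->]]; last by apply: (memT _ _ _ 1 g11); rewrite prod; ring.
have unit d z : d != 0 -> span G (k d * z) -> span G z.
  by move=> d0 /(span_mul (k d^-1)); rewrite mulrA -rmorphM mulVf // rmorph1 mul1r.
case: tg => [x12|[x12 d0 _]].
  apply: (unit (x2 - x1)); first by rewrite subr_eq0 eq_sym.
  have -> : k (x2 - x1) * ((Y - L) * (X - k x3)) =
     1 * ((X - k x3) * ((X - k x1) * (Y - L)))
     + (-1) * ((X - k x3) * ((Y - L) * (X - k x2))) by ring.
  by apply: span_add; apply/span_mul/span_gen.
apply: unit d0 _.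
have -> : k (2 * y1 + a1 * x1 + a3) * ((Y - L) * (X - k x3)) =
   (X - k x3) * ((X - k x3) * ((X - k x1) * (X - k x2)))
   + ((-1) * ((X - k x3) * ((Y - L) * (Y - L)))
   + (- k (a1 + 2 * l)) * ((X - k x3) * ((X - k x1) * (Y - L)))).
  transitivity ((X - k x3) * ((Y - L) * (Y - L'))
   + ((-1) * ((X - k x3) * ((Y - L) * (Y - L)))
   + (- k (a1 + 2 * l)) * ((X - k x3) * ((X - k x1) * (Y - L))))).
    by rewrite /L' /L; ring.
  by rewrite prod; ring.
by do ?apply: span_add; apply/span_mul/span_gen.
Qed.

Lemma pideal_add P Q : on_curve E P -> on_curve E Q ->
  cls (mulG (pideal P) (pideal Q)) (pideal (addp E P Q)).
Proof.
case: P Q => [[x1 y1]|] [[x2 y2]|] // W1 W2; try exact/eqG_cls/mul1G.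
  rewrite [addp _ _ _]/=; case: ifP => [/andP[/eqP x12 /eqP y12]|neg].
    have -> : Some (x2, y2) = negp E (Some (x1, y1)).
      by rewrite /= /negY y12 x12 /negY; congr (Some (_, _)); ring.
    apply: (cls_trans reg (eqG_cls (pideal_neg W1))).
    exact/cls_single/coord_Xsub_neq0.
  exact: pideal_chord.
exact/eqG_cls/mulG1.
Qed.

Lemma pideal_nonprincipal P : on_curve E P -> cls (pideal P) (single 1) -> P = None.
Proof.
case: P => [[x y]|] // W [f [g [f0 g0 [le1 le2]]]]; exfalso.
have cancel u v : f * u = f * v -> u = v.
  move=> e; apply: subr0_eq; have /reg [/eqP|] // : f * (u - v) = 0.
    by rewrite mulrBr e subrr.
  by rewrite (negPf f0).
have /span_dvd [h Sh gE] : span (mulG (single f) (pideal (Some (x, y)))) g.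
  by apply: le2; exists g => //; exists 1; rewrite ?mulr1.
have dvd z : pideal (Some (x, y)) z -> exists w, z = h * w.
  move=> Pz; have /span_dvd [w _ e] : span (mulG (single g) (single 1)) (f * z).
    by apply: le1; exists f => //; exists z.
  by exists w; apply: cancel; rewrite e gE mulrA.
have [w Ex] := dvd _ (or_introl erefl); have [v Ey] := dvd _ (or_intror erefl).
have [p hE [r pr1]] := coord_gcd size_wb size_wc Ex Ey.
pose ev (u : R) := u.1.[x] + u.2.[x] * y.
have ev0 z : span (pideal (Some (x, y))) z -> ev z = 0.
  elim=> [|a c w' Pc _ IH]; first by rewrite /ev /= !horner0 mul0r addr0.
  have -> : ev (a * c + w') = ev (a * c) + ev w'.
    by rewrite /ev /= !hornerD; ring.
  have -> : ev (a * c) = ev a * ev c.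
    apply/subr0_eq; transitivity (a.2.[x] * c.2.[x] *
      ((x ^+ 3 + a2 * x ^+ 2 + a4 * x + a6) - (y ^+ 2 + a1 * x * y + a3 * y))).
      by rewrite /ev /= !(hornerD, hornerN, hornerM, hornerX, hornerC); ring.
    by rewrite (eqP W) subrr mulr0.
  by rewrite IH; case: Pc => ->; rewrite /ev /= !hornerE; ring.
have := ev0 _ Sh; rewrite hE /ev /= horner0 mul0r addr0 => px.
by have /eqP := congr1 (horner^~ x) pr1; rewrite /= hornerM px mul0r hornerC eq_sym oner_eq0.
Qed.

Lemma pideal_inj P Q : on_curve E P -> on_curve E Q -> cls (pideal P) (pideal Q) -> P = Q.
Proof.
move=> WP WQ PQ; have WN := on_curve_neg WQ.
have addN S : on_curve E S -> addp E S (negp E S) = None.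
  case: S => [[x y]|] //= _; rewrite eqxx /=; case: ifP => // /negP[].
  by apply/eqP; rewrite /negY; ring.
have /(pideal_nonprincipal (on_curve_add WP WN)) :
    cls (pideal (addp E P (negp E Q))) (single 1).
  apply: (cls_trans reg (cls_sym (pideal_add WP WN))).
  apply: (cls_trans reg (cls_mull _ PQ)).
  by have := pideal_add WQ WN; rewrite addN.
case: P Q {WP WQ WN PQ} => [[x1 y1]|] [[x2 y2]|] //=.
case: ifP => // /andP[/eqP -> /eqP ->] _; congr (Some (_, _)); rewrite /negY; ring.
Qed.

Lemma addpC P Q : on_curve E P -> on_curve E Q -> addp E P Q = addp E Q P.
Proof.
move=> WP WQ; apply: pideal_inj; try exact: on_curve_add.
apply: (cls_trans reg (cls_sym (pideal_add WP WQ))).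
by apply: (cls_trans reg (eqG_cls (mulGC _ _))); apply: pideal_add.
Qed.

Lemma addpA P Q S : on_curve E P -> on_curve E Q -> on_curve E S ->
  addp E P (addp E Q S) = addp E (addp E P Q) S.
Proof.
move=> WP WQ WS; apply: pideal_inj; do ?[apply: on_curve_add => //].
have WPQ := on_curve_add WP WQ; have WQS := on_curve_add WQ WS.
apply: (cls_trans reg (cls_sym (pideal_add WP WQS))).
apply: (cls_trans reg (cls_mulr reg _ (cls_sym (pideal_add WQ WS)))).
apply: (cls_trans reg (eqG_cls (mulGA _ _ _))).
apply: (cls_trans reg (cls_mull _ (pideal_add WP WQ))).
exact: pideal_add.
Qed.

Lemma addNp P : on_curve E P -> addp E (negp E P) P = None.
Proof. by case: P => [[x y]|] //= _; rewrite !eqxx. Qed.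

End PointIdeals.

Section MordellWeil.
Variables (F : fieldType) (E : ellcurve F).

Record mordell_weil := MWPoint { point_val : option (F * F); point_on : on_curve E point_val }.
HB.instance Definition _ := [isSub for point_val].
HB.instance Definition _ := [Choice of mordell_weil by <:].

Definition point0 : mordell_weil := MWPoint (isT : on_curve E None).
Definition point_opp (P : mordell_weil) : mordell_weil := MWPoint (on_curve_neg (point_on P)).
Definition point_add (P Q : mordell_weil) : mordell_weil :=
  MWPoint (on_curve_add (point_on P) (point_on Q)).

Fact point_addA : associative point_add.
Proof. by move=> P Q S; apply: val_inj; apply: addpA; apply: point_on. Qed.
Fact point_addC : commutative point_add.
Proof. by move=> P Q; apply: val_inj; apply: addpC; apply: point_on. Qed.
Fact point_add0 : left_id point0 point_add.
Proof. by move=> P; apply: val_inj. Qed.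
Fact point_addN : left_inverse point0 point_opp point_add.
Proof. by move=> P; apply: val_inj; apply: addNp; apply: point_on. Qed.
HB.instance Definition _ := GRing.isZmodule.Build mordell_weil
  point_addA point_addC point_add0 point_addN.

End MordellWeil.

Definition Z_independent (A : zmodType) n (P : 'I_n -> A) : Prop :=
  forall c : 'I_n -> int, \sum_(i < n) P i *~ c i = 0 -> forall i, c i = 0.

(* The rank of an abelian group is the supremum of the sizes of its finite
   Z-linearly independent families (for a finitely generated group
   Z^r x torsion, this is r); it is at least n iff such a family of size n
   exists. *)
Definition rank_at_least (n : nat) (A : zmodType) : Prop :=
  exists P : 'I_n -> A, Z_independent P.

(* Main.v *)
From HB Require Import structures.
Require Import Defs.
From mathcomp Require Import all_boot all_order all_algebra all_field.
From mathcomp Require Import ring zify.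
From mathcomp Require Import boolp classical_sets functions cardinality.

Set Implicit Arguments.
Unset Strict Implicit.
Unset Printing Implicit Defensive.

Import Order.TTheory GRing.Theory Num.Theory.
Local Open Scope ring_scope.

(* Mestre's method: if A, B are monic quartics and A B = q^2 - r with q a
   quartic and deg r <= 3, then y^2 = r(x) has a rational point above every
   rational root of A B.  Take A = (x + 1)(x - 4)(x - 8)(x + 8), and for B the
   quartic with roots 3/4 (1 +- alpha)(1 +- beta), where
   alpha^2 + beta^2 = 18; then r(0) = 0, so that after scaling the curve is
   y^2 = x^3 + a x^2 + b x, of which three roots of A and three roots of B give
   six points.  The 2-descent homomorphism P |-> x(P) to Q^*/Q^{*2} sends these
   points and the point (0, 0) to seven independent classes: the parameter t of
   the circle alpha^2 + beta^2 = 18 is prescribed modulo seven primes, each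
   seeing exactly one of the classes as a nonresidue, and modulo 7 so that
   there is no other rational 2-torsion.  Since (0, 0) is not divisible by 2
   either, the six points are independent over Q, hence over K.  The
   j-invariant is a nonconstant function of t, so the curves fall into
   infinitely many isomorphism classes over K. *)

(** * Squares and the 2-descent map *)

Section Squares.
Variable F : fieldType.
Implicit Types u v w : F.

Definition is_square u := exists w, u = w ^+ 2.

Lemma is_square_sqr u : is_square (u ^+ 2). Proof. by exists u. Qed.

Lemma is_square1 : is_square 1. Proof. by exists 1; rewrite expr1n. Qed.

Lemma is_squareM u v : is_square u -> is_square v -> is_square (u * v).
Proof. by move=> [x ->] [y ->]; exists (x * y); rewrite exprMn. Qed.

Lemma is_squareMr u v : v != 0 -> is_square v -> is_square (u * v) -> is_square u.
Proof.
move=> v0 [y yE] [x xE]; have y0 : y != 0 by move: v0; rewrite yE expf_eq0.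
by exists (x / y); rewrite expr_div_n -xE -yE mulfK.
Qed.

Lemma is_square_trans u v w : v != 0 ->
  is_square (u * v) -> is_square (v * w) -> is_square (u * w).
Proof.
move=> v0 uv vw; apply: (@is_squareMr _ (v ^+ 2)); first by rewrite expf_neq0.
  exact: is_square_sqr.
by have := is_squareM uv vw; congr is_square; ring.
Qed.

End Squares.

Section Weierstrass.
Variable F : fieldType.
Implicit Types a b : F.

Lemma disc_two_torsion a b :
  weierstrass_disc 0 a 0 b 0 = 16 * b ^+ 2 * (a ^+ 2 - 4 * b).
Proof. by rewrite /weierstrass_disc; ring. Qed.

Lemma disc_two_torsion_neq0 a b :
  weierstrass_disc 0 a 0 b 0 != 0 -> b ^+ 2 * (a ^+ 2 - 4 * b) != 0.
Proof. by rewrite disc_two_torsion -mulrA mulf_eq0 => /norP[]. Qed.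

Variables a b : F.
Hypothesis disc : weierstrass_disc 0 a 0 b 0 != 0.
Let E := EllCurve disc.

Let b0 : b != 0.
Proof.
by apply: contra disc => /eqP ->; rewrite disc_two_torsion expr0n mulr0 mul0r.
Qed.

Fact zero_on_curve : on_curve E (Some (0, 0)).
Proof. by apply/eqP; rewrite /=; ring. Qed.

Definition torsion_point : mordell_weil E := MWPoint zero_on_curve.

(* The 2-descent map E(F) -> F^*/F^{*2}, on representatives. *)
Definition descent (P : mordell_weil E) : F :=
  if point_val P is Some (x, _) then if x == 0 then b else x else 1.

Lemma descent_neq0 P : descent P != 0.
Proof.
by rewrite /descent; case: (point_val P) => [[x y]|]; [case: ifP => // -> | rewrite oner_eq0].
Qed.

Lemma descent0 : descent 0 = 1. Proof. by []. Qed.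

Lemma descent_torsion : descent torsion_point = b.
Proof. by rewrite /descent /= eqxx. Qed.

(** The abscissas of [P], [Q] and [P + Q] are the roots of the cubic cut out by a line
    [y = l x + m], so their product is [m ^+ 2]. If one of them is 0, then [m = 0] and [b] is the
    product of the other two. *)
Lemma descentD P Q : is_square (descent (P + Q) * (descent P * descent Q)).
Proof.
have sq := @is_square_sqr F.
case: P Q => [[[x1 y1]|] W1] [[[x2 y2]|] W2]; rewrite /descent /=; last 3 first.
- by rewrite mulr1 -expr2.
- by rewrite mul1r -expr2.
- by rewrite !mulr1; exact: is_square1.
case: ifP => [/andP[/eqP -> _]|neg]; first by rewrite mul1r -expr2.
have [] := line_coefs W1 W2 neg; have [y2E _] := slopeP W1 W2 neg; move: y2E.
set l := slope _ _ _ _ _; set x3 := _ - x1 - x2; set m := y1 - l * x1 => y2E /= e4 e6.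
have {e4} e4 : b = 2 * l * m + (x1 * x2 + x1 * x3 + x2 * x3) by rewrite [LHS]e4; ring.
have {e6} e6 : x1 * x2 * x3 = m ^+ 2.
  by apply/eqP; rewrite eq_sym -subr_eq0; apply/eqP; rewrite [RHS]e6; ring.
have x0 x : x = 0 -> x \in [:: x1; x2; x3] -> m = 0.
  move=> ->; rewrite !inE => x0; apply/eqP; rewrite -sqrf_eq0 -e6.
  by rewrite !mulf_eq0; case/or3P: x0 => /eqP <-; rewrite eqxx ?orbT.
have bE x : x = 0 -> x \in [:: x1; x2; x3] -> b = x1 * x2 + x1 * x3 + x2 * x3.
  by move=> xe xi; rewrite {1}e4 (x0 x) // mulr0 add0r.
have [x1e|x1n] := eqVneq x1 0; have [x2e|x2n] := eqVneq x2 0.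
(* Both points would be the 2-torsion point, its own negative, contrary to [neg]. *)
- move: neg; rewrite x1e x2e eqxx /= /negY /= mul0r !subr0.
  move/eqP: W1; move/eqP: W2; rewrite /= x1e x2e !mul0r !expr0n /= !mulr0 !addr0.
  by move=> /eqP; rewrite sqrf_eq0 => /eqP -> /eqP; rewrite sqrf_eq0 => /eqP ->; rewrite oppr0 eqxx.
- have be := bE _ x1e (mem_head _ _); rewrite x1e !mul0r !add0r in be.
  have x3n : x3 != 0 by move: b0; rewrite be mulf_eq0 negb_or => /andP[].
  by rewrite (negPf x3n) be; have := sq (x2 * x3); congr is_square; ring.
- have be : b = x1 * x3.
    by rewrite (bE _ x2e) ?inE ?eqxx ?orbT // x2e mulr0 mul0r add0r addr0.
  have x3n : x3 != 0 by move: b0; rewrite be mulf_eq0 negb_or => /andP[].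
  by rewrite (negPf x3n) be; have := sq (x1 * x3); congr is_square; ring.
have [x3e|x3n] := eqVneq x3 0.
  have be : b = x1 * x2.
    by rewrite (bE _ x3e) ?inE ?eqxx ?orbT // x3e !mulr0 !addr0.
  by rewrite be -expr2.
by rewrite mulrC e6.
Qed.

(** A point equal to its negative has [y = 0]. If [x] is nonzero, it is a root of [x^2 + a x + b],
    whose discriminant is then the square of [2 * x + a]. *)
Lemma two_torsion P : ~ is_square (a ^+ 2 - 4 * b) -> P + P = 0 ->
  P = 0 \/ P = torsion_point.
Proof.
move=> nsq PP; case: P PP => [[[x y]|] W] PP; last by left; apply: val_inj.
move/(congr1 val): PP => /=; case: ifP => // /andP[_ /eqP] /= yE _.
have char2 : 2 != 0 :> F.
  apply/eqP => c2; have /eqP := disc; apply; rewrite disc_two_torsion.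
  by transitivity (2 * (8 * b ^+ 2 * (a ^+ 2 - 4 * b))); [ring | rewrite c2 mul0r].
have y0 : y = 0.
  apply/eqP; rewrite -(mulrI_eq0 _ (lregP char2)); apply/eqP.
  by rewrite mulr_natl mulr2n {1}yE /negY /=; ring.
have [x0|x0] := eqVneq x 0; first by right; apply: val_inj; rewrite /= x0 y0.
case: nsq; exists (2 * x + a); move/eqP: W; rewrite /= y0 => W.
have /eqP : x * (x ^+ 2 + a * x + b) = 0.
  by transitivity (x ^+ 3 + a * x ^+ 2 + b * x + 0); [ring | rewrite -W; ring].
rewrite mulf_eq0 (negPf x0) /= => /eqP q.
by apply/subr0_eq; transitivity (- 4 * (x ^+ 2 + a * x + b)); [ring | rewrite q mulr0].
Qed.

End Weierstrass.

(** Zero counts as a square, so a zero entry taken alone would violate independence. *)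
Lemma free_neq0 (F : fieldType) n (u : 'I_n -> F) :
    (forall e : 'I_n -> bool, is_square (\prod_i u i ^+ e i) -> forall i, e i = false) ->
  forall i, u i != 0.
Proof.
move=> ind i; apply/eqP => ui; suff : pred1 i i = false by rewrite /= eqxx.
by apply: ind; exists 0; rewrite (bigD1 i) //= ui eqxx expr1 expr0n mul0r.
Qed.

(** * Independence of points by infinite descent *)

Section Independence.
Variables (F : fieldType) (a b : F).
Hypothesis disc : weierstrass_disc 0 a 0 b 0 != 0.
Let E := EllCurve disc.
Implicit Types P Q : mordell_weil E.

Lemma descentN P : descent (- P) = descent P.
Proof. by case: P => [[[x y]|] W]. Qed.

Lemma descent_trans P Q u v :
  is_square (descent P * u) -> is_square (descent Q * v) ->
  is_square (descent (P + Q) * (u * v)).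
Proof.
move=> Pu Qv; apply: (is_square_trans _ (descentD P Q)).
  by rewrite mulf_neq0 ?descent_neq0.
by have := is_squareM Pu Qv; congr is_square; ring.
Qed.

Lemma descent_mulrn P u n : u != 0 -> is_square (descent P * u) ->
  is_square (descent (P *+ n) * u ^+ odd n).
Proof.
move=> u0 Pu; elim: n => [|n IH]; first by rewrite mulr1; apply: is_square1.
rewrite mulrS /=; have := descent_trans Pu IH; case: (odd n); rewrite !mulr1 //.
by rewrite -expr2; apply/is_squareMr/is_square_sqr; rewrite expf_neq0.
Qed.

Lemma descent_mulrz P u (c : int) : u != 0 -> is_square (descent P * u) ->
  is_square (descent (P *~ c) * u ^+ odd `|c|).
Proof.
move=> u0 Pu; case: c => n; first exact: descent_mulrn.
by rewrite NegzE mulrNz descentN abszN; apply: descent_mulrn.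
Qed.

(** Modulo squares only the parity of each coefficient matters. *)
Lemma descent_sum n (P : 'I_n -> mordell_weil E) (u : 'I_n -> F) (c : 'I_n -> int) :
    (forall i, u i != 0) -> (forall i, is_square (descent (P i) * u i)) ->
  is_square (descent (\sum_i P i *~ c i) * \prod_i u i ^+ odd `|c i|).
Proof.
move=> u0 Pu; elim/big_rec2: _ => [|i v S _ IH]; first by rewrite mulr1; apply: is_square1.
by apply: descent_trans IH; apply: descent_mulrz.
Qed.

(* Infinite descent: a relation, possibly up to the point of order 2, has even
   coefficients, and halving them gives a relation of the same kind. *)
Lemma descent_independent n (P : 'I_n -> mordell_weil E) (u : 'I_n.+1 -> F) :
    ~ is_square (a ^+ 2 - 4 * b) ->
    is_square (b * u ord0) ->
    (forall i, is_square (descent (P i) * u (lift ord0 i))) ->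
    (forall e : 'I_n.+1 -> bool, is_square (\prod_i u i ^+ e i) ->
       forall i, e i = false) ->
  Z_independent P.
Proof.
move=> nsq bu Pu ind.
have u0 := free_neq0 ind.
suff main M (c : 'I_n -> int) : (forall i, `|c i| <= M)%N ->
    \sum_i P i *~ c i = 0 \/ \sum_i P i *~ c i = torsion_point disc ->
  forall i, c i = 0.
  move=> c c0; apply: (main (\sum_i `|c i|)%N) => [i|]; last by left.
  by rewrite (bigD1 i) //= leq_addr.
elim/ltn_ind: M c => M IH c cM rel.
(* The exponent [e0] of [u ord0] is split off; it is set to [true] when the torsion point
   contributes its class [b]. *)
have {}ind (e0 : bool) : is_square (\prod_i u (lift ord0 i) ^+ odd `|c i| * u ord0 ^+ e0) ->
    e0 = false /\ forall i, odd `|c i| = false.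
  pose e j := if unlift ord0 j is Some i then odd `|c i| else e0.
  move=> sq; have {}ind : forall j, e j = false.
    apply: ind; rewrite big_ord_recl /e unlift_none mulrC.
    by under eq_bigr => i _ do rewrite liftK.
  split=> [|i]; first by have := ind ord0; rewrite /e unlift_none.
  by have := ind (lift ord0 i); rewrite /e liftK.
have sq := descent_sum c (fun i => u0 (lift ord0 i)) Pu.
have even i : odd `|c i| = false.
  case: rel => rel; rewrite rel in sq.
    by apply: (ind false _).2; rewrite mulr1; rewrite descent0 mul1r in sq.
  apply: (ind true _).2; rewrite expr1; rewrite descent_torsion mulrC in sq.
  by apply: (is_square_trans _ sq bu); rewrite -(descent_torsion disc) descent_neq0.
have [h cE] : exists h : 'I_n -> int, forall i, c i = h i + h i.
  exists (fun i => (c i %/ 2)%Z) => i; have := even i; lia.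
have half : \sum_i P i *~ c i = \sum_i P i *~ h i + \sum_i P i *~ h i.
  by rewrite -big_split; apply: eq_bigr => i _; rewrite cE mulrzDr.
have [M0|M0] := posnP M; first by move=> i; have := cM i; lia.
suff h0 : forall i, h i = 0 by move=> i; rewrite cE h0.
apply: (IH (M./2)); first by lia.
  by move=> i; have := cM i; rewrite cE; lia.
apply: (two_torsion nsq); rewrite -half; case: rel => // rel.
(* The torsion point is not a double: otherwise [b], and with it [u ord0], would be a square. *)
have [] // := ind true; rewrite expr1 big1 => [|i _]; last by rewrite even.
rewrite mul1r; apply: (@is_squareMr _ _ b).
- by rewrite -(descent_torsion disc) descent_neq0.
- rewrite -(descent_torsion disc) -rel half.
  have := descentD (\sum_i P i *~ h i) (\sum_i P i *~ h i).
  by rewrite -expr2; apply/is_squareMr/is_square_sqr; rewrite expf_neq0 // descent_neq0.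
- by rewrite mulrC.
Qed.

End Independence.

(** * Detecting square classes modulo primes *)

Section SquaresModPrimes.

(** A rational square root of an integer is an integer, since the square of its denominator divides
    1; it can therefore be reduced modulo [p]. *)
Lemma intr_square_mod p (N : int) : prime p ->
  is_square (N%:~R : rat) -> is_square (N%:~R : 'F_p).
Proof.
move=> pr [q qE].
have {qE} e : numq q ^+ 2 = N * denq q ^+ 2.
  by apply/(intr_inj (R := rat)); rewrite !expr2 !intrM numqE qE; ring.
have d1 : (denq q ^+ 2 %| 1)%Z.
  have co : coprimez (denq q ^+ 2) (numq q ^+ 2).
    by rewrite coprimez_pexpl // coprimez_pexpr // coprimez_sym; apply: coprime_num_den.
  by rewrite -(Gauss_dvdzl _ co) e mul1r dvdz_mull.
exists (numq q)%:~R; rewrite -rmorphXn /= e; congr _%:~R.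
have -> : denq q ^+ 2 = 1; last by rewrite mulr1.
by move: d1 (Num.Theory.sqr_ge0 (denq q)); rewrite dvdz1; lia.
Qed.

(** Modulo [p] the other factors are nonzero squares and can be cancelled, so if [z i] occurred it
    would be a square as well. *)
Lemma exponent_eq0 p n (z : 'I_n -> int) (e : 'I_n -> bool) i : prime p ->
    ~ is_square ((z i)%:~R : 'F_p) ->
    (forall j, j != i -> is_square ((z j)%:~R : 'F_p) /\ (z j)%:~R != 0 :> 'F_p) ->
    is_square (\prod_j (z j)%:~R ^+ e j : rat) ->
  e i = false.
Proof.
move=> pr nsq other sq; apply/negP => ei; apply: nsq.
have {sq} : is_square ((\prod_j z j ^+ e j)%:~R : 'F_p).
  apply: intr_square_mod => //; move: sq; congr is_square.
  by rewrite rmorph_prod; apply: eq_bigr => j _; rewrite rmorphXn.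
rewrite rmorph_prod (bigD1 i) //= ei expr1; apply: is_squareMr.
  by apply/prodf_neq0 => j /other[_ z0]; rewrite rmorphXn expf_neq0.
apply: big_ind => [||j /other[sq _]]; [exact: is_square1 | exact: is_squareM |].
by rewrite rmorphXn /=; case: (e j); [rewrite expr1 | exact: is_square1].
Qed.

End SquaresModPrimes.

(** * Base change and the j-invariant *)

Section BaseChange.
Variables (F K : fieldType) (f : {rmorphism F -> K}) (E : ellcurve F).

Fact disc_base_change :
  weierstrass_disc (f (a1 E)) (f (a2 E)) (f (a3 E)) (f (a4 E)) (f (a6 E)) != 0.
Proof.
rewrite (_ : weierstrass_disc _ _ _ _ _ =
  f (weierstrass_disc (a1 E) (a2 E) (a3 E) (a4 E) (a6 E))).
  by rewrite fmorph_eq0 disc_neq0.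
rewrite /weierstrass_disc !(rmorphN, rmorphB, rmorphD, rmorphM, rmorphXn, rmorph_nat) /=.
by ring.
Qed.

Definition base_change : ellcurve K := EllCurve disc_base_change.

Definition map_coords (P : option (F * F)) : option (K * K) :=
  if P is Some (x, y) then Some (f x, f y) else None.

Lemma on_curve_map P : on_curve E P -> on_curve base_change (map_coords P).
Proof.
by case: P => [[x y]|] //= /eqP e; rewrite -!(rmorphXn, rmorphM, rmorphD) /= e.
Qed.

Lemma negY_map x y : negY base_change (f x) (f y) = f (negY E x y).
Proof. by rewrite /negY !(rmorphB, rmorphN, rmorphM). Qed.

Lemma slope_map x1 y1 x2 y2 :
  slope base_change (f x1) (f y1) (f x2) (f y2) = f (slope E x1 y1 x2 y2).
Proof.
rewrite /slope fmorph_eq; case: ifP => _.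
  by rewrite fmorph_div !(rmorph_nat, rmorphXn, rmorphB, rmorphD, rmorphM).
by rewrite fmorph_div !rmorphB.
Qed.

Lemma addp_map P Q :
  addp base_change (map_coords P) (map_coords Q) = map_coords (addp E P Q).
Proof.
case: P Q => [[x1 y1]|] [[x2 y2]|] //=; rewrite negY_map !fmorph_eq.
case: ifP => //= _; rewrite slope_map; set l := slope _ _ _ _ _.
have -> : f l ^+ 2 + f (a1 E) * f l - f (a2 E) - f x1 - f x2 =
    f (l ^+ 2 + a1 E * l - a2 E - x1 - x2).
  by rewrite !(rmorphB, rmorphD, rmorphM, rmorphXn).
by rewrite -!(rmorphB, rmorphM, rmorphD) negY_map.
Qed.

Definition map_mw (P : mordell_weil E) : mordell_weil base_change :=
  MWPoint (on_curve_map (point_on P)).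

Lemma map_mw_inj : injective map_mw.
Proof.
move=> [[[x y]|] P] [[[x' y']|] Q] // /(congr1 val) //= e; apply: val_inj => //=.
by case: e => /fmorph_inj -> /fmorph_inj ->.
Qed.

Fact map_mw_zmod : zmod_morphism map_mw.
Proof.
move=> P Q; apply: val_inj; rewrite /= -addp_map; congr (addp _ _ _).
by case: (point_val Q) => [[x y]|] //=; rewrite negY_map.
Qed.
HB.instance Definition _ :=
  GRing.isZmodMorphism.Build (mordell_weil E) (mordell_weil base_change) map_mw map_mw_zmod.

(** [map_mw] is an injective group morphism, so relations over [K] come from [F]. *)
Lemma rank_base_change n :
  rank_at_least n (mordell_weil E) -> rank_at_least n (mordell_weil base_change).
Proof.
move=> [P ind]; exists (fun i => map_mw (P i)) => c rel; apply: ind.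
apply: map_mw_inj; rewrite raddf_sum raddf0 -[RHS]rel.
by apply: eq_bigr => i _; rewrite raddfMz.
Qed.

End BaseChange.

Section Invariants.
Variable F : fieldType.

(* For [y^2 = x^3 + a x^2 + b x] the j-invariant is
   [256 (a^2 - 3 b)^3 / (b^2 (a^2 - 4 b))]. *)
Lemma isomorphic_j (E E' : ellcurve F) : 2 != 0 :> F ->
    [/\ a1 E = 0, a3 E = 0 & a6 E = 0] -> [/\ a1 E' = 0, a3 E' = 0 & a6 E' = 0] ->
    isomorphic E E' ->
  (a2 E ^+ 2 - 3 * a4 E) ^+ 3 * (a4 E' ^+ 2 * (a2 E' ^+ 2 - 4 * a4 E')) =
  (a2 E' ^+ 2 - 3 * a4 E') ^+ 3 * (a4 E ^+ 2 * (a2 E ^+ 2 - 4 * a4 E)).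
Proof.
move=> two0 [E1 E3 E6] [E1' E3' E6'] [u [r [s [t [u0 e1 e2 [e3 e4 e6]]]]]].
rewrite {}E1 {}E3 {}E6 {}E1' {}E3' {}E6' in e1 e2 e3 e4 e6.
have half (x : F) : 2 * x = 0 -> x = 0 by move=> /eqP; rewrite mulf_eq0 (negPf two0) => /eqP.
(* Only the scaling by [u] and the translation by [r] survive. *)
have s0 : s = 0 by apply: half; rewrite mulr0 add0r in e1; rewrite -e1.
have t0 : t = 0 by apply: half; rewrite !mulr0 !add0r in e3; rewrite -e3.
move: e2 e4 e6; rewrite s0 t0; set a := a2 E; set b := a4 E; set a' := a2 E'; set b' := a4 E'.
move=> e2 e4 e6.
have {}e2 : u ^+ 2 * a' = a + 3 * r by rewrite e2; ring.
have {}e4 : u ^+ 4 * b' = b + 2 * r * a + 3 * r ^+ 2 by rewrite e4; ring.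
have {}e6 : r * b + r ^+ 2 * a + r ^+ 3 = 0 by rewrite -[RHS](mulr0 (u ^+ 6)) e6; ring.
have c4 : a ^+ 2 - 3 * b = u ^+ 4 * (a' ^+ 2 - 3 * b').
  by transitivity ((u ^+ 2 * a') ^+ 2 - 3 * (u ^+ 4 * b')); [rewrite e2 e4; ring | ring].
have dE : b ^+ 2 * (a ^+ 2 - 4 * b) = u ^+ 12 * (b' ^+ 2 * (a' ^+ 2 - 4 * b')).
  transitivity ((u ^+ 4 * b') ^+ 2 * ((u ^+ 2 * a') ^+ 2 - 4 * (u ^+ 4 * b'))); last by ring.
  (* These are the coefficients of the cubic translated by [r]. The discriminant of a cubic is
     invariant under translation, and [C] vanishes. *)
  pose A := a + 3 * r; pose B := b + 2 * r * a + 3 * r ^+ 2; pose C := r * b + r ^+ 2 * a + r ^+ 3.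
  rewrite e2 e4 -/A -/B.
  transitivity (B ^+ 2 * (A ^+ 2 - 4 * B) + C * (18 * A * B - 4 * A ^+ 3 - 27 * C)).
    by rewrite /A /B /C; ring.
  by rewrite {1}/C e6 mul0r addr0.
by rewrite c4 dE; ring.
Qed.

End Invariants.

(** The relation between j-invariants has its terms in [F], and [f] is injective. *)
Lemma isomorphic_base_change_j (F K : fieldType) (f : {rmorphism F -> K})
    (E E' : ellcurve F) : 2 != 0 :> F ->
    [/\ a1 E = 0, a3 E = 0 & a6 E = 0] -> [/\ a1 E' = 0, a3 E' = 0 & a6 E' = 0] ->
    isomorphic (base_change f E) (base_change f E') ->
  (a2 E ^+ 2 - 3 * a4 E) ^+ 3 * (a4 E' ^+ 2 * (a2 E' ^+ 2 - 4 * a4 E')) =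
  (a2 E' ^+ 2 - 3 * a4 E') ^+ 3 * (a4 E ^+ 2 * (a2 E ^+ 2 - 4 * a4 E)).
Proof.
move=> two0 [E1 E3 E6] [E1' E3' E6'] /isomorphic_j; rewrite /= E1 E3 E6 E1' E3' E6' rmorph0.
have two0K : 2 != 0 :> K by rewrite -(rmorph_nat f) fmorph_eq0.
move=> /(_ two0K (And3 erefl erefl erefl) (And3 erefl erefl erefl)) e.
apply: (fmorph_inj f); rewrite !(rmorph_nat, rmorphXn, rmorphB, rmorphM).
by move: e.
Qed.

(** * The family of curves *)

(* The circle [alpha^2 + beta^2 = 18] is parametrized by
   [alpha = 3 fam_p t / fam_tau t], [beta = 3 fam_q t / fam_tau t]. *)
Definition fam_tau (R : comNzRingType) (t : R) : R := 1 + t ^+ 2.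
Definition fam_p (R : comNzRingType) (t : R) : R := 1 + 2 * t - t ^+ 2.
Definition fam_q (R : comNzRingType) (t : R) : R := 1 - 2 * t - t ^+ 2.
Definition fam_nu (R : comNzRingType) (t : R) : R :=
  17 * fam_tau t ^+ 4 - 81 * (fam_p t * fam_q t) ^+ 2.
(** Represents [mestre_c (fam_n t)] modulo squares. *)
Definition fam_c (R : comNzRingType) (t : R) : R :=
  2 * (9 * fam_nu t + 256 * fam_tau t ^+ 4) * (3 * fam_nu t - 128 * fam_tau t ^+ 4).

(* Polynomials in [t] representing, modulo squares, the images under descent of
   the 2-torsion point and of the six points. *)
Definition fam_class (R : comNzRingType) (t : R) : seq R :=
  let T := fam_tau t in let p := fam_p t in let q := fam_q t in
  [:: - 30 * fam_nu t * (3 * fam_nu t - 128 * T ^+ 4);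
      - fam_c t; fam_c t; 2 * fam_c t;
      3 * fam_c t * (T + 3 * p) * (T + 3 * q);
      3 * fam_c t * (T - 3 * p) * (T + 3 * q);
      3 * fam_c t * (T + 3 * p) * (T - 3 * q)].

(* [a^2 - 4 b] modulo squares. *)
Definition fam_quad (R : comNzRingType) (t : R) : R :=
  let v := 9 * fam_nu t in let w := 16 * fam_tau t ^+ 4 in
  81 * (17 * v ^+ 2 + 384 * v * w + 2 ^+ 13 * w ^+ 2) ^+ 2 +
  45 * 2 ^+ 11 * v * (v + 16 * w) ^+ 2 * (v - 24 * w).

Section Morph.
Variables (R S : comNzRingType) (f : {rmorphism R -> S}) (t : R).

Let fE := (rmorph_nat, rmorph1, rmorphXn, rmorphN, rmorphB, rmorphD, rmorphM).

Lemma fam_tau_morph : f (fam_tau t) = fam_tau (f t). Proof. by rewrite /fam_tau !fE. Qed.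
Let pE : f (fam_p t) = fam_p (f t). Proof. by rewrite /fam_p !fE. Qed.
Let qE : f (fam_q t) = fam_q (f t). Proof. by rewrite /fam_q !fE. Qed.
Lemma fam_nu_morph : f (fam_nu t) = fam_nu (f t).
Proof. by rewrite /fam_nu !(fE, fam_tau_morph, pE, qE). Qed.
Let cE : f (fam_c t) = fam_c (f t).
Proof. by rewrite /fam_c !(fE, fam_tau_morph, fam_nu_morph). Qed.

Lemma fam_class_morph i : f (nth 0 (fam_class t) i) = nth 0 (fam_class (f t)) i.
Proof.
have -> : fam_class (f t) = map f (fam_class t).
  by rewrite /fam_class [RHS]/= !(fE, cE, fam_tau_morph, pE, qE, fam_nu_morph).
have [i7|i7] := ltnP i 7; first by rewrite (nth_map 0).
by rewrite !nth_default ?rmorph0.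
Qed.

Lemma fam_quad_morph : f (fam_quad t) = fam_quad (f t).
Proof. by rewrite /fam_quad !(fE, fam_tau_morph, fam_nu_morph). Qed.

End Morph.

(** * Quadratic residues of the classes modulo primes *)

Section Residues.
Variable p : nat.
Implicit Types u : 'F_p.

(** Exhaustive search, so that [vm_compute] can decide; [(Zp_trunc (pdiv p)).+2] is the number of
    elements of ['F_p]. *)
Definition square_test u :=
  has (fun k => k%:R ^+ 2 == u) (iota 0 (Zp_trunc (pdiv p)).+2).

Lemma square_testP u : reflect (is_square u) (square_test u).
Proof.
apply: (iffP hasP) => [[k _ /eqP <-]|[w ->]]; first exact: is_square_sqr.
exists (nat_of_ord w); first by rewrite mem_iota /=; apply: ltn_ord.
by rewrite natr_Zp.
Qed.

Definition only_nonsquare (s : seq 'F_p) i :=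
  all (fun j => if j == i then ~~ square_test (nth 0 s j)
     else square_test (nth 0 s j) && (nth 0 s j != 0)) (iota 0 7).

Lemma fam_exponent_eq0 (r : nat) (t : int) (e : 'I_7 -> bool) (i : 'I_7) : prime p ->
    t%:~R = r%:R :> 'F_p -> only_nonsquare (fam_class (r%:R : 'F_p)) i ->
    is_square (\prod_(j < 7) (nth 0 (fam_class t) j)%:~R ^+ e j : rat) ->
  e i = false.
Proof.
move=> pr tr /allP test.
have zE j : (nth 0 (fam_class t) j)%:~R = nth 0 (fam_class (r%:R : 'F_p)) j.
  by rewrite -tr; exact: (fam_class_morph intr).
apply: (exponent_eq0 (z := fun j : 'I_7 => nth 0 (fam_class t) j) pr) => [|j ji].
  rewrite zE; apply/square_testP.
  by have := test i; rewrite eqxx mem_iota /=; apply; apply: ltn_ord.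
rewrite zE; have := test j; rewrite (negPf (ji : val j != val i)) mem_iota /= ltn_ord.
by move=> /(_ isT) /andP[/square_testP].
Qed.

End Residues.

Lemma only_nonsquare_73 : only_nonsquare (fam_class (27%:R : 'F_73)) 0. Proof. by vm_compute. Qed.
Lemma nonsquare_7 : ~~ square_test (fam_quad (1%:R : 'F_7)). Proof. by vm_compute. Qed.
Lemma only_nonsquare_31 : only_nonsquare (fam_class (2%:R : 'F_31)) 1. Proof. by vm_compute. Qed.
Lemma only_nonsquare_43 : only_nonsquare (fam_class (2%:R : 'F_43)) 2. Proof. by vm_compute. Qed.
Lemma only_nonsquare_53 : only_nonsquare (fam_class (23%:R : 'F_53)) 3. Proof. by vm_compute. Qed.
Lemma only_nonsquare_97 : only_nonsquare (fam_class (4%:R : 'F_97)) 4. Proof. by vm_compute. Qed.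
Lemma only_nonsquare_41 : only_nonsquare (fam_class (14%:R : 'F_41)) 5. Proof. by vm_compute. Qed.
Lemma only_nonsquare_89 : only_nonsquare (fam_class (7%:R : 'F_89)) 6. Proof. by vm_compute. Qed.

(** * Mestre's construction and its parametrization *)

Section Mestre.
Variable F : numFieldType.
Implicit Types n x al be t : F.

(* All coefficients depend on [alpha], [beta] through
   [n = 9/16 (17 - (alpha beta)^2)] only.  One has
   [r = mestre_c n x^3 + mestre_a n x^2 + ...] and
   [mestre_b n = mestre_c n * r'(0)]: the curve [y^2 = r(x)] is made monic by
   [x |-> mestre_c n * x]. *)
Definition mestre_a n : F := 9 / 4 * (17 * n ^+ 2 + 384 * n + 2 ^+ 13).
Definition mestre_b n : F := - 1440 * n * (n + 16) ^+ 2 * (n - 24).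
Definition mestre_c n : F := 6 * (n + 16) * (n - 24).
Definition mestre_A x : F := (x + 1) * (x - 4) * (x - 8) * (x + 8).
Definition mestre_B n x : F :=
  x ^+ 4 - 3 * x ^+ 3 + (2 * n - 36) * x ^+ 2 + 3 * n * x + n ^+ 2.

(* [r = (v + 16 (n + 16))^2 - (n + 16)^2 A = (v - n (n + 16))^2 - (n + 16)^2 B]. *)
Lemma mestre_point n x : mestre_A x * mestre_B n x = 0 ->
  exists y, y ^+ 2 = (mestre_c n * x) ^+ 3 + mestre_a n * (mestre_c n * x) ^+ 2 +
    mestre_b n * (mestre_c n * x).
Proof.
pose v := - (n + 16) * x ^+ 2 + (96 - 3 / 2 * n) * x.
move=> /eqP; rewrite mulf_eq0 => /orP[] /eqP r0.
  (* Making [r] monic multiplies its values by [mestre_c n ^+ 2], hence the factor [mestre_c n]. *)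
  exists (mestre_c n * (v + 16 * (n + 16))).
  rewrite -[RHS]addr0 -(mulr0 (mestre_c n ^+ 2 * (n + 16) ^+ 2)) -r0.
  by rewrite /v /mestre_A /mestre_c /mestre_a /mestre_b; field.
exists (mestre_c n * (v - n * (n + 16))).
rewrite -[RHS]addr0 -(mulr0 (mestre_c n ^+ 2 * (n + 16) ^+ 2)) -r0.
by rewrite /v /mestre_B /mestre_c /mestre_a /mestre_b; field.
Qed.

(** The circle equation turns [n] into [- 9/16 (1 - al^2) (1 - be^2)]; the value is then a multiple
    of [18 - (al^2 + be^2)]. *)
Lemma mestre_B_root al be : al ^+ 2 + be ^+ 2 = 18 ->
  mestre_B (9 / 16 * (17 - (al * be) ^+ 2)) (3 / 4 * (1 + al) * (1 + be)) = 0.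
Proof.
move=> e; have -> : 17 - (al * be) ^+ 2 = - ((1 - al ^+ 2) * (1 - be ^+ 2)).
  by rewrite exprMn -[al ^+ 2](addrK (be ^+ 2)) e; ring.
transitivity (- (9 / 4) * (18 - (al ^+ 2 + be ^+ 2)) * (3 / 4 * (1 + al) * (1 + be)) ^+ 2).
  by rewrite /mestre_B; field.
by rewrite e subrr mulr0 mul0r.
Qed.

Section Parametrization.
Variable t : F.
Local Notation T := (fam_tau t).
Hypothesis T0 : T != 0.

Definition fam_alpha : F := 3 * fam_p t / T.
Definition fam_beta : F := 3 * fam_q t / T.
Definition fam_n : F := 9 / 16 * (17 - (fam_alpha * fam_beta) ^+ 2).

Lemma fam_circle : fam_alpha ^+ 2 + fam_beta ^+ 2 = 18.
Proof. by rewrite /fam_alpha /fam_beta; move: T0; rewrite /fam_tau /fam_p /fam_q => T0'; field. Qed.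

Lemma fam_nE : fam_n = 9 * fam_nu t / (16 * T ^+ 4).
Proof. by rewrite /fam_n /fam_alpha /fam_beta /fam_nu; field. Qed.

Definition fam_roots : seq F :=
  [:: -1; 4; 8; 3 / 4 * (1 + fam_alpha) * (1 + fam_beta);
      3 / 4 * (1 - fam_alpha) * (1 + fam_beta); 3 / 4 * (1 + fam_alpha) * (1 - fam_beta)].

Lemma fam_rootsP i : (i < 6)%N ->
  mestre_A (nth 0 fam_roots i) * mestre_B fam_n (nth 0 fam_roots i) = 0.
Proof.
(* [fam_n] depends only on the squares of [fam_alpha] and [fam_beta], so every choice of signs gives
   a root. *)
have neg al be : al ^+ 2 = fam_alpha ^+ 2 -> be ^+ 2 = fam_beta ^+ 2 ->
    mestre_B fam_n (3 / 4 * (1 + al) * (1 + be)) = 0.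
  move=> ea eb; rewrite /fam_n exprMn -ea -eb -exprMn; apply: mestre_B_root.
  by rewrite ea eb fam_circle.
case: i => [|[|[|[|[|[|//]]]]]] _; rewrite [nth _ _ _]/=; try by rewrite /mestre_A; ring.
- by rewrite neg ?mulr0.
- by rewrite neg ?mulr0 ?sqrrN.
- by rewrite neg ?mulr0 ?sqrrN.
Qed.

Lemma fam_classP i : (i < 6)%N -> exists2 s, s != 0 &
  mestre_c fam_n * nth 0 fam_roots i = nth 0 (fam_class t) i.+1 * s ^+ 2.
Proof.
have cE : mestre_c fam_n = fam_c t * (3 / (16 * T ^+ 4)) ^+ 2.
  by rewrite fam_nE /mestre_c /fam_c; field.
have s0 : 3 / (16 * T ^+ 4) != 0 by rewrite !(mulf_neq0, invr_neq0, expf_neq0) // pnatr_eq0.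
(* This is the previous factor divided by [2 * T]: the [1/4] and the two denominators [T] in the
   last three roots form the square of [1 / (2 * T)]. *)
have s1 : 3 / (32 * T ^+ 5) != 0 by rewrite !(mulf_neq0, invr_neq0, expf_neq0) // pnatr_eq0.
have s2 : 2 * (3 / (16 * T ^+ 4)) != 0 by rewrite mulf_neq0 // pnatr_eq0.
case: i => [|[|[|[|[|[|//]]]]]] _; rewrite cE [nth 0 fam_roots _]/= [nth 0 (fam_class t) _]/=.
- by exists (3 / (16 * T ^+ 4)) => //; ring.
- by exists (2 * (3 / (16 * T ^+ 4))) => //; ring.
- by exists (2 * (3 / (16 * T ^+ 4))) => //; ring.
- by exists (3 / (32 * T ^+ 5)) => //; rewrite /fam_alpha /fam_beta; field.
- by exists (3 / (32 * T ^+ 5)) => //; rewrite /fam_alpha /fam_beta; field.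
- by exists (3 / (32 * T ^+ 5)) => //; rewrite /fam_alpha /fam_beta; field.
Qed.

Lemma fam_bP : is_square (mestre_b fam_n * nth 0 (fam_class t) 0).
Proof.
exists (36 * (fam_n + 16) / (16 * T ^+ 4) * nth 0 (fam_class t) 0).
by rewrite fam_nE /mestre_b [nth _ _ _]/=; field.
Qed.

Lemma fam_quadP : is_square (mestre_a fam_n ^+ 2 - 4 * mestre_b fam_n) ->
  is_square (fam_quad t).
Proof.
move=> [w wE]; exists (4 * (16 * T ^+ 4) ^+ 2 * w); rewrite exprMn -wE.
by rewrite fam_nE /mestre_a /mestre_b /fam_quad; field.
Qed.

End Parametrization.

End Mestre.

(** * Nonsingularity and rank of a member of the family *)

Section FamilyMember.
Variables (F : numFieldType) (t : F).
Hypothesis T0 : fam_tau t != 0.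
Hypothesis free : forall e : 'I_7 -> bool,
  is_square (\prod_(i < 7) nth 0 (fam_class t) i ^+ e i) -> forall i, e i = false.
Hypothesis nsq : ~ is_square (fam_quad t).
Local Notation n := (fam_n t).

Let quad_nonsquare : ~ is_square (mestre_a n ^+ 2 - 4 * mestre_b n).
Proof. by move/(fam_quadP T0). Qed.

Let class0 i (i7 : (i < 7)%N) : nth 0 (fam_class t) i != 0.
Proof. exact: (free_neq0 free (Ordinal i7)). Qed.

Let root0 i : (i < 6)%N -> mestre_c n * nth 0 (fam_roots t) i != 0.
Proof.
by move=> i6; have [s s0 ->] := fam_classP T0 i6; rewrite mulf_neq0 ?expf_neq0 ?class0.
Qed.

(** Independent classes are nonzero, which forces [n], [n + 16] and [n - 24] to be nonzero; the
    remaining factor is a nonsquare. *)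
Lemma mestre_disc : weierstrass_disc 0 (mestre_a n) 0 (mestre_b n) 0 != 0.
Proof.
have d0 : mestre_a n ^+ 2 - 4 * mestre_b n != 0.
  by apply/eqP => d0; apply: quad_nonsquare; exists 0; rewrite d0 expr0n.
have num0 m : m.+1%:R != 0 :> F by rewrite pnatr_eq0.
have [n16 n24] : n + 16 != 0 /\ n - 24 != 0.
  have := root0 (isT : (0 < 6)%N); rewrite /mestre_c !mulf_eq0 !negb_or -!andbA.
  by case/and4P.
have n0 : n != 0.
  rewrite fam_nE // !(mulf_neq0, invr_neq0, expf_neq0) //.
  have := class0 (isT : (0 < 7)%N); rewrite [nth _ _ _]/= !mulf_eq0 !negb_or -!andbA.
  by case/and3P.
rewrite disc_two_torsion; move: d0 n0 n16 n24; rewrite /mestre_b.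
move: (mestre_a n) n => a m d0 m0 m16 m24.
by rewrite !mulf_neq0 ?expf_neq0 ?mulf_neq0 ?expf_neq0 ?oppr_eq0.
Qed.

Definition mestre_curve : ellcurve F := EllCurve mestre_disc.

Lemma mestre_rank : rank_at_least 6 (mordell_weil mestre_curve).
Proof.
have pts (i : 'I_6) : exists P : mordell_weil mestre_curve,
    is_square (descent P * nth 0 (fam_class t) (lift ord0 i)).
  have [y yE] := mestre_point (fam_rootsP T0 (ltn_ord i)).
  have W : on_curve mestre_curve (Some (mestre_c n * nth 0 (fam_roots t) i, y)).
    by apply/eqP; rewrite /= !mul0r !addr0 yE.
  exists (MWPoint W); rewrite lift0 /descent /= (negPf (root0 (ltn_ord i))).
  have [s _ ->] := fam_classP T0 (ltn_ord i).
  by exists (nth 0 (fam_class t) i.+1 * s); ring.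
have {pts} [P PE] := fin_all_exists pts; exists P.
apply: (descent_independent (u := fun i : 'I_7 => nth 0 (fam_class t) i)) PE _.
- exact: quad_nonsquare.
- exact: fam_bP T0.
- exact: free.
Qed.

End FamilyMember.

(** * Rational parameters satisfying the congruences *)

(* Mixed-radix form of the solutions [t] of the congruences [t = r (mod p)],
   [(p, r)] in [fam_residues]; small digits keep unary numerals small. *)
Definition fam_t (k : nat) : nat :=
  27 + 73 * (9 + 31 * (5 + 43 * (2 + 53 * (79 + 97 * (8 + 41 * (41 + 89 * (2 + 7 * k))))))).

Definition fam_residues : seq (nat * nat) :=
  [:: (73, 27); (31, 2); (43, 2); (53, 23); (97, 4); (41, 14); (89, 7); (7, 1)].

Lemma fam_t_mod k p r : (p, r) \in fam_residues -> (fam_t k)%:R = r%:R :> 'F_p.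
Proof.
move=> pr; rewrite -[LHS]Fp_nat_mod; last first.
  by move: pr; rewrite !inE => /or4P[||| /or4P[|||/orP[]]] /eqP[->].
congr _%:R; rewrite /fam_t; move: pr; rewrite !inE.
by move=> /or4P[||| /or4P[|||/orP[]]] /eqP[-> ->]; lia.
Qed.

(** Each index has its own prime, modulo which only that entry is a nonsquare. The product is first
    rewritten with integer entries so that it can be reduced. *)
Lemma fam_free k (e : 'I_7 -> bool) :
    is_square (\prod_(i < 7) nth 0 (fam_class ((fam_t k)%:R : rat)) i ^+ e i) ->
  forall i, e i = false.
Proof.
move=> sq.
have {}sq : is_square (\prod_(i < 7) (nth 0 (fam_class ((fam_t k)%:R : int)) i)%:~R ^+ e i : rat).
  move: sq; congr is_square; apply: eq_bigr => i _.
  by rewrite -[X in fam_class X](rmorph_nat intr) -(fam_class_morph intr).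
have tr p r : (p, r) \in fam_residues -> (fam_t k)%:R%:~R = r%:R :> 'F_p.
  by move=> pr; rewrite rmorph_nat; exact: (fam_t_mod k pr).
case=> [[|[|[|[|[|[|[|i]]]]]]] lt_i7]; last by [].
- exact (@fam_exponent_eq0 73 27 _ e (Ordinal lt_i7) isT (tr 73 27 isT) only_nonsquare_73 sq).
- exact (@fam_exponent_eq0 31 2 _ e (Ordinal lt_i7) isT (tr 31 2 isT) only_nonsquare_31 sq).
- exact (@fam_exponent_eq0 43 2 _ e (Ordinal lt_i7) isT (tr 43 2 isT) only_nonsquare_43 sq).
- exact (@fam_exponent_eq0 53 23 _ e (Ordinal lt_i7) isT (tr 53 23 isT) only_nonsquare_53 sq).
- exact (@fam_exponent_eq0 97 4 _ e (Ordinal lt_i7) isT (tr 97 4 isT) only_nonsquare_97 sq).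
- exact (@fam_exponent_eq0 41 14 _ e (Ordinal lt_i7) isT (tr 41 14 isT) only_nonsquare_41 sq).
- exact (@fam_exponent_eq0 89 7 _ e (Ordinal lt_i7) isT (tr 89 7 isT) only_nonsquare_89 sq).
Qed.

Lemma fam_quad_nonsquare k : ~ is_square (fam_quad ((fam_t k)%:R : rat)).
Proof.
move=> sq; have /negP := nonsquare_7; apply; apply/square_testP.
have -> : fam_quad (1%:R : 'F_7) = (fam_quad ((fam_t k)%:R : int))%:~R.
  rewrite -[LHS](congr1 (@fam_quad _) (@fam_t_mod k 7 1 isT)) [RHS](fam_quad_morph intr).
  by congr fam_quad; rewrite /= rmorph_nat.
apply: intr_square_mod => //; move: sq; congr is_square.
by rewrite [RHS](fam_quad_morph intr) [in RHS]/= rmorph_nat.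
Qed.

Lemma fam_tau_neq0 (t : rat) : fam_tau t != 0.
Proof. by rewrite /fam_tau lt0r_neq0 // ltr_wpDr ?sqr_ge0. Qed.

Definition fam_curve k : ellcurve rat :=
  mestre_curve (fam_tau_neq0 _) (@fam_free k) (@fam_quad_nonsquare k).

Lemma fam_rank k : rank_at_least 6 (mordell_weil (fam_curve k)).
Proof. exact: mestre_rank. Qed.

(** * Finite fibers and root sets *)

Section FiniteFibers.
Local Open Scope classical_set_scope.

Lemma finite_preimage_fibers T U (f : T -> U) (B : set U) : finite_set B ->
  (forall y, B y -> finite_set (f @^-1` [set y])) -> finite_set (f @^-1` B).
Proof.
move=> finB fin; rewrite (_ : f @^-1` B = \bigcup_(y in B) (f @^-1` [set y])).
  exact: bigcup_finite.
by apply/seteqP; split=> [x Bx|x [y By /= ->]] //; exists (f x).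
Qed.

Lemma finite_roots (F : fieldType) (p : {poly F}) : p != 0 ->
  finite_set [set x | root p x].
Proof.
move: {2}(size p) (leqnn (size p)) => m; elim: m p => [|m IH] p.
  by rewrite leqn0 size_poly_eq0 => ->.
move=> sp p0; have [[a /factor_theorem [q pE]]|no] := pselect (exists a, root p a).
  have q0 : q != 0 by apply: contra p0 => /eqP q0; rewrite pE q0 mul0r.
  apply: (@sub_finite_set _ _ ([set a] `|` [set x | root q x])).
    by move=> x /=; rewrite pE rootM root_XsubC => /orP[|/eqP ->]; [right|left].
  rewrite finite_setU; split; first exact: finite_set1.
  apply: (IH _ _ q0); move: sp; rewrite pE size_mul ?polyXsubC_eq0 // size_XsubC.
  by rewrite addn2.
by rewrite (_ : [set x | _] = set0) //; apply/seteqP; split=> // x rx; case: no; exists x.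
Qed.

End FiniteFibers.

Lemma isomorphic_refl (F : fieldType) (E : ellcurve F) : isomorphic E E.
Proof. by exists 1, 0, 0, 0; rewrite oner_neq0; split; [|ring|ring|split; ring]. Qed.

Section Invariant.
Variable F : numFieldType.
Local Open Scope classical_set_scope.

Lemma finite_fam_n (n0 : F) : finite_set [set t | fam_tau t != 0 /\ fam_n t = n0].
Proof.
pose Q : {poly F} := 9%:P * fam_nu 'X - n0%:P * (16%:P * fam_tau 'X ^+ 4).
have QE t : Q.[t] = 9 * fam_nu t - n0 * (16 * fam_tau t ^+ 4).
  have nuE := fam_nu_morph (horner_eval t) 'X; have tauE := fam_tau_morph (horner_eval t) 'X.
  rewrite /= /horner_eval hornerX in nuE tauE.
  by rewrite /Q hornerD hornerN !(horner_exp, hornerM) !hornerC nuE tauE.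
have Q0 : Q != 0.
  (* As [fam_tau 0 = 1] and [fam_tau 2 ^+ 4 = 625], this combination eliminates [n0]. *)
  apply/eqP => Q0; have : 625 * Q.[0] - Q.[2] = 0 by rewrite Q0 !horner0 mulr0 subrr.
  have -> : 625 * Q.[0] - Q.[2] = - 648 ^+ 2.
    by rewrite !QE /fam_nu /fam_tau /fam_p /fam_q; ring.
  by move/eqP; rewrite oppr_eq0 expf_eq0 pnatr_eq0.
apply: sub_finite_set (finite_roots Q0) => t [T0 nE] /=.
rewrite /root QE -nE fam_nE // divfK ?subrr //.
by rewrite mulf_neq0 ?expf_neq0 ?pnatr_eq0.
Qed.

Lemma finite_mestre_j (c d : F) : d != 0 -> 
  finite_set [set n | (mestre_a n ^+ 2 - 3 * mestre_b n) ^+ 3 * d =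
     c * (mestre_b n ^+ 2 * (mestre_a n ^+ 2 - 4 * mestre_b n))].
Proof.
move=> d0.
pose hE := (horner_exp, hornerM, hornerN, hornerD, hornerX, hornerC).
pose A : {poly F} := (9 / 4)%:P * (17%:P * 'X ^+ 2 + 384%:P * 'X + 2%:P ^+ 13).
pose B : {poly F} := - 1440%:P * 'X * ('X + 16%:P) ^+ 2 * ('X - 24%:P).
pose P := (A ^+ 2 - 3%:P * B) ^+ 3 * d%:P - c%:P * (B ^+ 2 * (A ^+ 2 - 4%:P * B)).
have AE n : A.[n] = mestre_a n by rewrite /A !hE.
have BE n : B.[n] = mestre_b n by rewrite /B !hE.
have PE n : P.[n] = (mestre_a n ^+ 2 - 3 * mestre_b n) ^+ 3 * d -
    c * (mestre_b n ^+ 2 * (mestre_a n ^+ 2 - 4 * mestre_b n)).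
  by rewrite -AE -BE /P; move: A B {AE BE} @P => A B P; rewrite !hE.
apply: sub_finite_set (finite_roots (p := P) _) => [n /= nE|].
  by rewrite /root PE nE subrr.
(* At 0 [mestre_b] vanishes, leaving [mestre_a 0 ^+ 6 * d], with [mestre_a 0] nonzero. *)
apply: contra d0 => /eqP P0; have := PE 0; rewrite P0 horner0.
have -> : mestre_b 0 = 0 :> F by rewrite /mestre_b; ring.
have -> : mestre_a 0 = 9 * 2 ^+ 11 :> F by rewrite /mestre_a; field.
move=> e; have /eqP : (9 * 2 ^+ 11) ^+ 6 * d = 0 by rewrite [RHS]e; ring.
by rewrite mulf_eq0 expf_eq0 mulf_eq0 expf_eq0 !pnatr_eq0.
Qed.

End Invariant.

Lemma fam_t_inj : injective (fun k => (fam_t k)%:R : rat).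
Proof. by move=> k l /eqP; rewrite eqr_nat /fam_t => /eqP; lia. Qed.

(** * Infinitely many isomorphism classes *)

Section Isomorphism.
Local Open Scope classical_set_scope.

(** The j-invariant is reached from [k] through [t] and then [n]; the first map is injective and the
    other two have finite fibers. *)
Lemma finite_isomorphic (K : fieldExtType rat) l :
  finite_set [set k | isomorphic (base_change (in_alg K) (fam_curve k))
                                 (base_change (in_alg K) (fam_curve l))].
Proof.
pose n k : rat := fam_n ((fam_t k)%:R).
pose J k := (mestre_a (n k) ^+ 2 - 3 * mestre_b (n k)) ^+ 3.
pose D k := mestre_b (n k) ^+ 2 * (mestre_a (n k) ^+ 2 - 4 * mestre_b (n k)).
have Dl : D l != 0 := disc_two_torsion_neq0 (disc_neq0 (fam_curve l)).
apply: (@sub_finite_set _ _ (n @^-1` [set m | (mestre_a m ^+ 2 - 3 * mestre_b m) ^+ 3 * D l =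
     J l * (mestre_b m ^+ 2 * (mestre_a m ^+ 2 - 4 * mestre_b m))])).
  have two0 : 2 != 0 :> rat by rewrite pnatr_eq0.
  have zero j : [/\ a1 (fam_curve j) = 0, a3 (fam_curve j) = 0 & a6 (fam_curve j) = 0] by split.
  by move=> k /(isomorphic_base_change_j two0 (zero k) (zero l)).
apply: finite_preimage_fibers (finite_mestre_j _ Dl) _ => m _.
apply: (@sub_finite_set _ _ ((fun k => (fam_t k)%:R : rat) @^-1`
    [set t | fam_tau t != 0 /\ fam_n t = m])).
  by move=> k nk; exact: conj (fam_tau_neq0 _) nk.
apply: finite_preimage_fibers (finite_fam_n m) _ => t _.
have [[k <-]|no] := pselect (exists k, (fam_t k)%:R = t).
  by apply: sub_finite_set (finite_set1 k) => j /= /fam_t_inj.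
by apply: sub_finite_set (@finite_set0 _) => k /= tE; case: no; exists k.
Qed.

End Isomorphism.

Local Open Scope classical_set_scope.

Theorem corollary1p2 (K : fieldExtType rat) :
  infinite_set (@isomorphism_class K @`
    [set E : ellcurve K | rank_at_least 6 (mordell_weil E)]).
Proof.
move=> fin; apply: infinite_nat.
pose E k := base_change (in_alg K) (fam_curve k).
pose C k := isomorphism_class (E k).
(* With finitely many classes, [nat] would be a finite union of fibers of [C], each of them
   finite. *)
have := finite_preimage_fibers (f := C) fin; rewrite (_ : C @^-1` _ = setT); last first.
  apply/seteqP; split=> // k _; exists (E k) => //.
  exact/rank_base_change/fam_rank.
apply=> _ [E0 _ <-].
have [[l lE]|no] := pselect (exists l, C l = isomorphism_class E0); last first.
  by apply: sub_finite_set (@finite_set0 _) => k /= kE; case: no; exists k.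
apply: sub_finite_set (finite_isomorphic K l) => k /= kE.
(* [E l] lies in its own class, which is also that of [E k]. *)
by have : C l (E l) := isomorphic_refl (E l); rewrite lE -kE.
Qed.
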